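(* Let $m,n\geq 1$ be integers, let $A\in\mathbb{R}^{m\times n}$, and let $\epsilon=(\epsilon_1,\ldots,\epsilon_{\min\{m,n\}})$ with each $\epsilon_r\in\{1,-1\}$; set $\epsilon_0:=1$. For every contiguous square submatrix $A_k$ of $A$ (of size $k\times k$, $1\leq k\leq\min\{m,n\}$), let an arbitrary vector $\mathbf{v}=(\alpha_1,-\alpha_2,\ldots,(-1)^{k-1}\alpha_k)^T\in\mathbb{R}^k$ with $\mathbf{v}\neq\mathbf{0}$ and all $\alpha_j\geq 0$ be fixed, and define $\mathbf{x}^{A_k}:=\mathrm{adj}(A_k)\mathbf{v}\in\mathbb{R}^k$. Then the following statements are equivalent. (1) $A$ is SSR$(\epsilon)$. (2) For all $\mathbf{x}\in\mathbb{R}^n$ with $\mathbf{x}\neq\mathbf{0}$, we have $S^+(A\mathbf{x})\leq S^-(\mathbf{x})$. Further, for all $\mathbf{x}\in\mathbb{R}^n$ with $A\mathbf{x}\neq\mathbf{0}$ and $S^+(A\mathbf{x})=S^-(\mathbf{x})=r$, if $0\leq r\leq\min\{m,n\}-1$, then the sign of the first (respectively last) component of $A\mathbf{x}$ (if this component is zero, the unique sign given to it in determining $S^+(A\mathbf{x})$) agrees with $\epsilon_r\epsilon_{r+1}$ times the sign of the first (respectively last) non-zero component of $\mathbf{x}$. (3) For every $1\leq k\leq\min\{m,n\}$ and every contiguous $k\times k$ submatrix $A_k$ of $A$, we have $S^+(A_k\mathbf{x}^{A_k})\leq S^-(\mathbf{x}^{A_k})$. Moreover, if $S^+(A_k\mathbf{x}^{A_k})=S^-(\mathbf{x}^{A_k})=r$,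 and if $0\leq r\leq k-1$, then the sign of the first (respectively last) component of $A_k\mathbf{x}^{A_k}$ (if this component is zero, the unique sign given to it in determining $S^+(A_k\mathbf{x}^{A_k})$) agrees with $\epsilon_r\epsilon_{r+1}$ times the sign of the first (respectively last) non-zero component of $\mathbf{x}^{A_k}$.
   Context: Sign changes: for $\mathbf{x}=(x_1,\ldots,x_n)^T\in\mathbb{R}^n$, $S^-(\mathbf{x})$ is the number of sign changes in the sequence $x_1,\ldots,x_n$ after discarding all zero entries, with $S^-(\mathbf{0}):=0$. For $\mathbf{x}\neq\mathbf{0}$, $S^+(\mathbf{x})$ is the maximum possible number of sign changes in the sequence obtained by assigning to each zero entry of $\mathbf{x}$ a value $1$ or $-1$; and $S^+(\mathbf{0}):=n$ for $\mathbf{0}\in\mathbb{R}^n$ (same convention in any dimension). If the first (or last) entry of a non-zero vector is zero, its ''unique sign given in determining $S^+$'' is the sign it receives in any assignment achieving the maximum number of sign changes. SSR$(\epsilon)$: a real $m\times n$ matrix $A$ is SSR$(\epsilon)$ (strictly sign regular with sign pattern $\epsilon=(\epsilon_1,\ldots,\epsilon_{\min\{m,n\}})$) if for each $1\leq r\leq\min\{m,n\}$ every $r\times r$ minor of $A$ is non-zero and has sign $\epsilon_r$. A contiguous submatrix is one whose rows and columns are indexed by consecutive integers. $\mathrm{adj}(A_k)$ denotes the adjugate matrix of $A_k$ (transpose of the cofactor matrix); for $k=1$, $\mathrm{adj}(A_1):=1$. *)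

(* Defs.v *)
From HB Require Import structures.
From mathcomp Require Import all_boot all_order all_algebra.
From mathcomp Require Import reals.
From mathcomp.real_closed Require qe_rcf_th.
Set Implicit Arguments.
Unset Strict Implicit.
Unset Printing Implicit Defensive.
Import Order.TTheory GRing.Theory Num.Theory.
Local Open Scope ring_scope.

Section SignChanges.
Variable R : realType.
Implicit Types m n k : nat.

Definition entries n (x : 'cV[R]_n) : seq R := [seq x i 0 | i : 'I_n].

Definition nonzero_entries n (x : 'cV[R]_n) : seq R :=
  [seq a <- entries x | a != 0].

(* qe_rcf_th.changes counts the adjacent pairs with a negative product, so   *)
(* it is the number of sign changes only for sequences without zeros.        *)
Definition Sminus n (x : 'cV[R]_n) : nat :=
  qe_rcf_th.changes (nonzero_entries x).

Definition fill_zeros n (x : 'cV[R]_n) (s : {ffun 'I_n -> bool}) : 'cV[R]_n :=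
  \col_i (if x i 0 == 0 then (-1) ^+ s i else x i 0).

Definition fill_changes n (x : 'cV[R]_n) (s : {ffun 'I_n -> bool}) : nat :=
  qe_rcf_th.changes (entries (fill_zeros x s)).

Definition Splus n (x : 'cV[R]_n) : nat :=
  if x == 0 then n else (\max_(s : {ffun 'I_n -> bool}) fill_changes x s)%N.

(* The first (last) sign of y is read off an assignment attaining S^+(y): it *)
(* is the sign of the first (last) component of y if that is non-zero, and   *)
(* otherwise the sign given to it in determining S^+(y). A non-zero y has    *)
(* such an assignment (Splus_attained), and all of them give the same first  *)
(* and the same last sign. The defaults of head and last are not reached     *)
(* when x and y are non-zero.                                                *)
Definition end_signs_agree m n (c : R) (y : 'cV[R]_m) (x : 'cV[R]_n) : Prop :=
  forall s : {ffun 'I_m -> bool}, fill_changes y s = Splus y ->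
    Num.sg (head 0 (entries (fill_zeros y s)))
      = c * Num.sg (head 0 (nonzero_entries x)) /\
    Num.sg (last 0 (entries (fill_zeros y s)))
      = c * Num.sg (last 0 (nonzero_entries x)).

Lemma Splus_attained n (y : 'cV[R]_n) :
  y != 0 -> exists s, fill_changes y s = Splus y.
Proof.
move=> /negbTE y0; rewrite /Splus y0.
have [|s ->] := @bigop.eq_bigmax {ffun 'I_n -> bool} (fill_changes y).
  by apply/card_gt0P; exists [ffun=> true].
by exists s.
Qed.

Definition SSR m n (eps : nat -> R) (A : 'M[R]_(m, n)) : Prop :=
  forall (r : nat) (f : 'I_r -> 'I_m) (g : 'I_r -> 'I_n),
    (1 <= r <= minn m n)%N ->
    {homo f : i j / (i < j)%N} -> {homo g : i j / (i < j)%N} ->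
    \det (mxsub f g A) != 0 /\ Num.sg (\det (mxsub f g A)) = eps r.

(* Rows i, ..., i + k - 1 and columns j, ..., j + k - 1 of A, from 0. *)
Definition contig_sub m n k i j (hi : (i + k <= m)%N) (hj : (j + k <= n)%N)
    (A : 'M[R]_(m, n)) : 'M[R]_k :=
  mxsub (fun a => widen_ord hi (rshift i a))
        (fun b => widen_ord hj (rshift j b)) A.

Definition alternate k (alpha : 'cV[R]_k) : 'cV[R]_k :=
  \col_a ((-1) ^+ a * alpha a 0).

End SignChanges.

(* Main.v *)
(* (1) => (2): grouping the coordinates of x into its p + 1 maximal runs of
   constant sign, p = S^-(x), turns A x into Y d, where Y is strictly sign
   regular with the signs of A and d is alternating.  If A x had p + 2 weakly
   alternating entries, then the linear relation between the corresponding rows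
   of Y, whose coefficients are its maximal minors, would be a sum of terms of
   one sign; Cramer's rule on p + 1 alternating entries gives the sign.
   (2) => (3): extend vectors by zeros.
   (3) => (1): A_k x = det(A_k) v has S^+ = k - 1, so that all entries of x are
   non-zero, and its first one is a nonnegative combination of minors of order
   k - 1; this gives the sign of det A_k by induction on k, and Fekete's
   argument passes from contiguous minors to all minors. *)
Require Import Defs.
From mathcomp Require Import all_boot all_order all_algebra.
From mathcomp Require Import reals perm zify ring lra.
From mathcomp.real_closed Require qe_rcf_th.
Set Implicit Arguments.
Unset Strict Implicit.
Unset Printing Implicit Defensive.
Import Order.TTheory GRing.Theory Num.Theory.
Local Open Scope ring_scope.

(** * Sign changes of finite real sequences *)

Section SequenceSigns.
Variable R : realType.
Implicit Types (a b c : R) (s : seq R).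
Local Notation changes := (@qe_rcf_th.changes R).
Local Notation nz := (fun a : R => a != 0).

Lemma sg_step a b : a != 0 -> b != 0 ->
  Num.sg b = Num.sg a * (-1) ^+ (a * b < 0)%R.
Proof.
move=> a0 b0; rewrite -sgr_lt0 sgrM.
by case: (sgrP a) a0; case: (sgrP b) b0 => //= *;
  rewrite ?mulr1 ?mulrN1 ?mul1r ?opprK ?ltr10 ?ltrN10 ?expr1 ?expr0 ?mulr1 ?mulrN1 ?opprK.
Qed.

Lemma changes_size s : (changes s <= (size s).-1)%N.
Proof.
(* [changes] compares the last entry with the default 0, and a zero product never counts as a
   change. *)
elim: s => //= a [|b s] IH /=; first by rewrite mulr0 ltxx.
by move: IH => /=; case: (_ < 0); lia.
Qed.

(** Repeating the pivot [a] in both parts keeps every adjacent pair and counts none twice. *)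
Lemma changes_cat s1 a s2 :
  changes (s1 ++ a :: s2) = (changes (rcons s1 a) + changes (a :: s2))%N.
Proof.
elim: s1 => [|b s1 IH]; first by rewrite /= mulr0 ltxx.
rewrite cat_cons rcons_cons [LHS]/= IH [in RHS]/= addnA; congr (_ + _ + _)%N.
by case: s1 {IH}.
Qed.

(** Every change flips the sign. This reduces claims on last signs to claims on first signs. *)
Lemma sg_last s : all nz s ->
  Num.sg (last 0 s) = Num.sg (head 0 s) * (-1) ^+ changes s.
Proof.
case: s => [|a s] /=; first by rewrite sgr0 mul0r.
elim: s a => [|b s IH] a; first by rewrite /= mulr0 ltxx mulr1.
move=> /andP[a0 bs]; rewrite /= IH // (@sg_step a b) // ?exprD ?mulrA //.
by case/andP: bs.
Qed.

Lemma changes_infix s1 s s2 : s != [::] ->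
  (changes s <= changes (s1 ++ s ++ s2))%N.
Proof.
case: s => // a s _; rewrite changes_cat (leq_trans _ (leq_addl _ _)) //.
by rewrite -cat_cons lastI cat_rcons changes_cat leq_addr.
Qed.

(** Equality leaves no change on either side of [s], so the sign is constant from each end up to the
    border of [s]. *)
Lemma changes_infix_ends s1 s s2 : s != [::] -> all nz (s1 ++ s ++ s2) ->
  changes (s1 ++ s ++ s2) = changes s ->
  Num.sg (head 0 (s1 ++ s ++ s2)) = Num.sg (head 0 s) /\
  Num.sg (last 0 (s1 ++ s ++ s2)) = Num.sg (last 0 s).
Proof.
case: s => // a s _; rewrite !all_cat => /and3P[n1 n n2].
rewrite changes_cat -cat_cons [in changes (_ ++ s2)]lastI cat_rcons changes_cat -lastI.
set c1 := changes (rcons s1 a); set c2 := changes (_ :: s2) => e.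
have [c10 c20] : c1 = 0%N /\ c2 = 0%N by lia.
split.
  have : all nz (rcons s1 a) by rewrite all_rcons n1 andbT; case/andP: n.
  by move=> /sg_last; rewrite -/c1 c10 mulr1 last_rcons => ->; case: (s1).
have : all nz (last a s :: s2) by rewrite /= n2 andbT; apply: (allP n); apply: mem_last.
by move=> /sg_last; rewrite -/c2 c20 mulr1 !last_cat /= => ->.
Qed.

(* Position i belongs to block b i; the blocks are the maximal runs of
   constant sign, zeros being attached to a neighbouring block. *)
Lemma sign_blocks s : has nz s ->
  let t := filter nz s in
  exists b : nat -> nat,
  [/\ {homo b : i j / (i <= j)%N},
      forall i, (b i <= changes t)%N,
      forall i, s`_i != 0 -> Num.sg s`_i = Num.sg (head 0 t) * (-1) ^+ b i
    & forall q, (q <= changes t)%N -> exists2 i, s`_i != 0 & b i = q].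
Proof.
elim: s => //= a s IH; have [->|a0] := eqVneq a 0.
  rewrite /= => /IH[b [bm bc bs bt]].
  (* The leading zero joins the block of its successor: [i.-1] identifies positions 0 and 1. *)
  exists (fun i => b i.-1); split.
  - by move=> i j ij; apply: bm; lia.
  - by move=> i; apply: bc.
  - by case=> [|i] /=; rewrite ?eqxx //; apply: bs.
  - by move=> q /bt[i i0 <-]; exists i.+1.
move=> _; have [hs|hs] := boolP (has nz s); last first.
  have s0 i : s`_i = 0.
    have [si|si] := ltnP i (size s); last by rewrite nth_default.
    by apply/eqP/negPn; apply: (hasPn hs); apply: mem_nth.
  have -> : filter nz s = [::] by apply/eqP; move: hs; rewrite has_filter negbK.
  rewrite /= mulr0 ltxx; exists (fun=> 0%N); split=> //.
    by case=> [|i] /=; rewrite ?mulr1 // s0 eqxx.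
  by case=> // _; exists 0%N.
have [b [bm bc bs bt]] := IH hs.
have: all nz (filter nz s) by apply: filter_all.
move: bc bs bt; case E: (filter nz s) hs => [|c t].
  by move=> hs; move: (hs); rewrite has_filter E.
move=> hs bc bs bt /andP[c0 _].
(* [d] is 1 exactly when the next non-zero entry [c] opens a new block. *)
pose d : nat := (a * c < 0)%R.
exists (fun i => if i is j.+1 then d + b j else 0)%N; split.
- by move=> [|i] [|j] //= ij; rewrite leq_add2l; apply: bm.
- by case=> [|i] //=; rewrite leq_add2l; apply: bc.
- case=> [|i] /=; rewrite ?mulr1 // => i0.
  by rewrite bs // exprD mulrA -sg_step.
- move=> q /= qc; have [->|q0] := posnP q; first by exists 0%N.
  have dq : (d <= q)%N by rewrite /d; case: (_ < 0).
  have [|i i0 bi] := bt (q - d)%N; first by rewrite /= leq_subLR.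
  by exists i.+1 => //; rewrite bi subnKC.
Qed.

End SequenceSigns.

(** * Determinant identities: linear relation between maximal minors, Cauchy-Binet *)

Section Minors.
Variable F : comNzRingType.

Lemma det_expand_col q (C : 'M[F]_q.+1) (s : 'I_q.+1) :
  \det C = (-1) ^+ s *
    \sum_(l < q.+1) (-1) ^+ l * C l s * \det (row' l (col' s C)).
Proof.
rewrite (expand_det_col _ s) mulr_sumr; apply: eq_bigr => l _.
by rewrite /cofactor exprD; ring.
Qed.

(** Prefixing [V] by a copy of its column [j] gives a matrix [C j] with two equal columns; its zero
    determinant is expanded along the new column, and linearity gives a general [d]. *)
Lemma maximal_minors_mul q (V : 'M[F]_(q.+1, q)) (d : 'cV_q) :
  \sum_(l < q.+1) (-1) ^+ l * (V *m d) l 0 * \det (row' l V) = 0.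
Proof.
pose C j : 'M[F]_q.+1 :=
  \matrix_(i, k) (if unlift ord0 k is Some k' then V i k' else V i j).
have C0 j : \sum_(l < q.+1) (-1) ^+ l * V l j * \det (row' l V) = 0.
  rewrite -[RHS](@determinant_alternate _ _ (C j)^T ord0 (lift ord0 j)).
  - rewrite det_tr (det_expand_col _ ord0) mul1r; apply: eq_bigr => l _.
    rewrite mxE unlift_none; congr (_ * \det _).
    by apply/matrixP=> i k; rewrite !mxE liftK.
  - exact: neq_lift.
  - by move=> i; rewrite !mxE unlift_none liftK.
rewrite (eq_bigr (fun l : 'I_q.+1 => \sum_j d j 0 * ((-1) ^+ l * V l j * \det (row' l V)))).
  rewrite exchange_big /= big1 // => j _.
  by rewrite -mulr_sumr C0 mulr0.
move=> l _; rewrite [(V *m d) l 0]mxE; move: (\det _) => D.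
rewrite mulr_sumr mulr_suml; apply: eq_bigr => j _; ring.
Qed.

(** Cauchy-Binet before grouping: the sum runs over all maps. In the application below, the maps
    with a non-zero product turn out to be increasing. *)
Lemma det_mul_expand q n (A : 'M[F]_(q, n)) (B : 'M[F]_(n, q)) :
  \det (A *m B) =
    \sum_(f : {ffun 'I_q -> 'I_n}) (\prod_c B (f c) c) * \det (mxsub id f A).
Proof.
rewrite -det_tr [LHS]/determinant; pose T (s : 'S_q) i j := A (s i) j * B j i.
transitivity (\sum_(s : 'S_q) \sum_(f : {ffun 'I_q -> 'I_n})
    (-1) ^+ s * \prod_i T s i (f i)).
  apply: eq_bigr => s _; rewrite -mulr_sumr -bigA_distr_bigA.
  by congr (_ * _); apply: eq_bigr => i _; rewrite !mxE.
rewrite exchange_big; apply: eq_bigr => f _ /=.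
rewrite -det_tr mulr_sumr; apply: eq_bigr => s _.
rewrite [RHS]mulrCA -big_split /=; congr (_ * _).
by apply: eq_bigr => i _; rewrite !mxE mulrC.
Qed.

End Minors.

(** * A three-term Pluecker relation between minors of orders p + 2 and p + 1 *)

Section Pluecker.
Variables (R : realType) (a : nat -> nat -> R).
Implicit Types (f : nat -> nat).

Definition minor q f : R := \det (\matrix_(i < q, j < q) a (f i) j).

Lemma eq_minor q f g : (forall i, (i < q)%N -> f i = g i) ->
  minor q f = minor q g.
Proof.
by move=> fg; congr (\det _); apply/matrixP=> i j; rewrite !mxE fg.
Qed.

(** Up to a global sign, the cofactors of a further row adjoined to the rows [f 0], ..., [f (q - 1)]
    over the first q + 1 columns. *)
Definition cominor q f j : R :=
  (-1) ^+ j * \det (\matrix_(i < q, k < q) a (f i) (bump j k)).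

Lemma minor_expand q f (s : nat) : (s <= q)%N ->
  minor q.+1 f =
    (-1) ^+ s * \sum_(j < q.+1) a (f s) j * cominor q (f \o bump s) j.
Proof.
move=> sq; have sq' : (s < q.+1)%N by [].
rewrite /minor -det_tr (det_expand_col _ (Ordinal sq')); congr (_ * _).
apply: eq_bigr => j _; rewrite !mxE mulrAC mulrC -det_tr; congr (_ * (_ * \det _)).
by apply/matrixP=> i k; rewrite !mxE.
Qed.

Lemma eq_cominor q f g j : (forall i, (i < q)%N -> f i = g i) ->
  cominor q f j = cominor q g j.
Proof.
by move=> fg; congr (_ * \det _); apply/matrixP=> i k; rewrite !mxE fg.
Qed.

(** The relation between maximal minors, read on the transpose with a basis vector for [d]. *)
Lemma cominor_row0 q f (i : 'I_q) :
  \sum_(j < q.+1) a (f i) j * cominor q f j = 0.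
Proof.
pose V : 'M[R]_(q.+1, q) := \matrix_(j, l) a (f l) j.
rewrite -[RHS](maximal_minors_mul V (delta_mx i 0)).
apply: eq_bigr => j _; rewrite /cominor -colE !mxE mulrCA mulrA -det_tr.
by congr (_ * _ * \det _); apply/matrixP=> k l; rewrite !mxE.
Qed.

(* The maximal minors of the p + 3 rows, with alternating signs, kill every
   column; paired with the cofactors of the p rows other than 0, t, p + 2,
   only these three rows contribute. *)
Lemma three_term p f (t : nat) : (0 < t < p.+2)%N ->
  minor p.+2 (f \o bump t) * minor p.+1 (f \o bump 0) =
    minor p.+2 (f \o bump 0) * minor p.+1 (f \o bump t) +
    minor p.+2 (f \o bump p.+2) * minor p.+1 (f \o bump t \o bump 0).
Proof.
move=> /andP[t0 tp].
(* The first p values of [N] are the rows other than 0, t and p + 2; [g i] is, up to sign, the minor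
   on these rows and row i, hence 0 when row i is one of them. *)
pose N : nat -> nat := f \o bump t \o bump 0.
pose g i := \sum_(j < p.+1) a (f i) j * cominor p N j.
have gN i : (i < p.+3)%N -> i != 0%N -> i != t -> i != p.+2 -> g i = 0.
  move=> ip i0 it ip2.
  pose i' := unbump 0 (unbump t i).
  have ip' : (i' < p)%N by rewrite /i' /unbump; lia.
  rewrite -(cominor_row0 N (Ordinal ip')); apply: eq_bigr => j _.
  by congr (a _ _ * _); rewrite /N /= /i' /bump /unbump; congr f; lia.
have E0 : minor p.+1 (f \o bump t) = g 0%N.
  rewrite (@minor_expand _ _ 0) // mul1r; apply: eq_bigr => j _ /=.
  by rewrite {1}/bump leqNgt t0.
have Et : minor p.+1 (f \o bump 0) = (-1) ^+ t.-1 * g t.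
  rewrite (@minor_expand _ _ t.-1); last lia.
  congr (_ * _); apply: eq_bigr => j _ /=.
  rewrite /bump /= add1n prednK //; congr (_ * _).
  by apply: eq_cominor => i ip; rewrite /N /= /bump; congr f; lia.
have El : minor p.+1 (f \o bump t \o bump 0) = (-1) ^+ p * g p.+2.
  rewrite (@minor_expand _ _ p) //; congr (_ * _); apply: eq_bigr => j _ /=.
  congr (a _ _ * _); first by rewrite /bump; congr f; lia.
  by apply: eq_cominor => i ip; rewrite /N /= /bump; congr f; lia.
pose V : 'M[R]_(p.+3, p.+2) := \matrix_(l, j) a (f l) j.
(* The minors of order p + 1 do not involve the last column, whence the last coordinate 0. *)
pose d : 'cV[R]_p.+2 := \col_j (if (j < p.+1)%N then cominor p N j else 0).
have gV (l : 'I_p.+3) : (V *m d) l 0 = g l.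
  rewrite mxE big_ord_recr /= !mxE ltnn mulr0 addr0; apply: eq_bigr => j _.
  by rewrite !mxE /= ltn_ord.
have mV (l : 'I_p.+3) : \det (row' l V) = minor p.+2 (f \o bump l).
  by congr (\det _); apply/matrixP=> i j; rewrite !mxE.
have := maximal_minors_mul V d.
have tp' : (t < p.+3)%N by lia.
rewrite (bigD1 ord0) //= (bigD1 ord_max) //= (bigD1 (Ordinal tp')) /=; last first.
  by rewrite -!val_eqE /=; lia.
rewrite big1 ?addr0; last first.
  move=> l; rewrite -!val_eqE /= => /andP[/andP[l0 lp] lt].
  by rewrite gV gN ?mulr0 ?mul0r.
rewrite !gV !mV E0 Et El /=.
case: t t0 {tp E0 Et El gN N g d gV tp'} (g t) (g 0%N) (g p.+2) => // t _ x y z /=.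
rewrite !exprS expr0.
set m1 := minor _ _; set m2 := minor _ _; set m3 := minor _ _.
move: ((-1) ^+ t : R) ((-1) ^+ p : R) => u v; lra.
Qed.

End Pluecker.

(** * Fekete's argument: from contiguous minors to all minors *)

Section Fekete.
Variable R : realType.
Implicit Types (a : nat -> nat -> R) (eps : nat -> R) (f g : nat -> nat).

Lemma sg_add (x y e : R) : Num.sg x = e -> Num.sg y = e -> Num.sg (x + y) = e.
Proof.
move=> <-; case: (sgrP x) => hx /eqP; rewrite sgr_cp0 => hy.
- by rewrite hx (eqP hy) addr0 sgr0.
- by rewrite gtr0_sg // addr_gt0.
- by rewrite ltr0_sg // -oppr_gt0 opprD addr_gt0 ?oppr_gt0.
Qed.

(** Induction on the order, then on the spread [f p.+1 - f 0]. If the rows have a gap after [f i],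
    inserting the row [(f i).+1] gives p + 3 rows, and the three-term relation expresses the minor
    through minors of smaller order or smaller spread. *)
Lemma fekete_rows a eps K M N :
  (forall q, (0 < q <= K)%N -> eps q != 0) ->
  (forall q i c, (0 < q <= K)%N -> (i + q <= M)%N -> (c + q <= N)%N ->
     Num.sg (minor (fun i j => a i (c + j)%N) q (addn i)) = eps q) ->
  forall q f c, (0 < q <= K)%N ->
    (forall i j, (i < j < q)%N -> (f i < f j)%N) -> (f q.-1 < M)%N ->
    (c + q <= N)%N ->
    Num.sg (minor (fun i j => a i (c + j)%N) q f) = eps q.
Proof.
move=> e0 ha q; elim: q => // -[_|p IHp] f c.
  move=> K1 _ fM cN; rewrite -(ha 1%N (f 0%N) c) //; last by rewrite addn1.
  by congr Num.sg; apply: eq_minor => -[|//] _; rewrite addn0.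
move=> pK; have [s] := ubnP (f p.+1 - f 0%N)%N.
elim: s f => // s IHs f fs fm fM cN.
have [/forallP gap|] := boolP [forall i : 'I_p.+1, f i.+1 == (f i).+1].
  have fE i : (i < p.+2)%N -> f i = (f 0 + i)%N.
    elim: i => [|i IH] ip; first by rewrite addn0.
    by have /eqP /= -> := gap (Ordinal (ip : (i < p.+1)%N)); rewrite IH ?addnS //; apply: ltnW.
  rewrite -(ha p.+2 (f 0%N) c) //; first by congr Num.sg; apply: eq_minor => i; apply: fE.
  by move: fM; have := fE p.+1 (ltnSn _); rewrite /=; lia.
case/forallPn=> -[i ip] /= fi.
have {}fi : ((f i).+1 < f i.+1)%N by move: (fm i i.+1); lia.
(* [g] is [f] with the missing row inserted at position [i.+1]; omitting this position gives back
   [f]. *)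
pose g (k : nat) := if (k <= i)%N then f k else if k == i.+1 then (f i).+1 else f k.-1.
have gm k l : (k < l < p.+3)%N -> (g k < g l)%N.
  move=> /andP[kl lp].
  have le u v : (u <= v < p.+2)%N -> (f u <= f v)%N.
    by case: (ltngtP u v) => [uv|//|-> //] /= vp; rewrite ltnW // fm // uv.
  rewrite /g; case: (leqP k i) => ki; case: (leqP l i) => li.
  - by apply: fm; lia.
  - case: eqVneq => [_|l1]; first by rewrite ltnS; apply: le; lia.
    have := le k i; have := le i.+1 l.-1; lia.
  - lia.
  case: (eqVneq l) => l1; first lia.
  case: eqVneq => k1; last by apply: fm; lia.
  by apply: leq_trans fi _; apply: le; lia.
have gf : forall k, (k < p.+2)%N -> (g \o bump i.+1) k = f k.
  move=> k kp; rewrite /g /= /bump; case: ltnP => ki.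
    by rewrite ifF ?ifF //; apply/negbTE; lia.
  by rewrite ifT //; lia.
have g0 : g 0%N = f 0%N by [].
have gl : g p.+2 = f p.+1 by rewrite /g ifF ?ifF //; apply/negbTE; lia.
pose m q f := minor (fun i j => a i (c + j)%N) q f.
have bm (h : nat) k l : (k < l)%N -> (bump h k < bump h l)%N by rewrite /bump; lia.
have bb (h : nat) k : (bump h k <= k.+1)%N by rewrite /bump; lia.
have gp : (g p.+1 < f p.+1)%N by rewrite -gl gm //; lia.
have A1 : Num.sg (m p.+1 (g \o bump 0)) = eps p.+1.
  apply: IHp; [lia| | |lia].
    by move=> k l kl; apply: gm; rewrite bm //=; move: (bb 0%N l); lia.
  exact: ltn_trans gp fM.
have A2 : Num.sg (m p.+1 (g \o bump i.+1)) = eps p.+1.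
  apply: IHp; [lia| | |lia].
    by move=> k l kl; apply: gm; rewrite bm //=; move: (bb i.+1 l); lia.
  rewrite gf //= (leq_trans _ fM) //=; have := fm p p.+1; lia.
have A3 : Num.sg (m p.+1 (g \o bump i.+1 \o bump 0)) = eps p.+1.
  apply: IHp; [lia| | |lia].
    move=> k l kl; apply: gm; rewrite !bm //=; last lia.
    by move: (bb i.+1 (bump 0 l)) (bb 0%N l); lia.
  by rewrite [(_ \o _) _]/= -[g _]/((g \o bump i.+1) _) gf // /bump /=; lia.
(* Dropping the first or the last row of [g] strictly reduces the spread. *)
have B1 : Num.sg (m p.+2 (g \o bump 0)) = eps p.+2.
  apply: IHs => //.
  - change (g p.+2 - g 1%N < s)%N; have := gm 0%N 1%N isT.
    by rewrite gl g0; have := fm 0%N p.+1; lia.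
  - by move=> k l kl; apply: gm; rewrite bm //=; move: (bb 0%N l); lia.
  - by rewrite /= /bump /= gl.
have bid k : (k < p.+2)%N -> bump p.+2 k = k by rewrite /bump; lia.
have B2 : Num.sg (m p.+2 (g \o bump p.+2)) = eps p.+2.
  apply: IHs => //=; rewrite ?bid //.
  - by rewrite g0; have := fm 0%N p.+1; lia.
  - by move=> k l kl; rewrite !bid ?gm //; lia.
  - exact: ltn_trans gp fM.
have Ef : m p.+2 f = m p.+2 (g \o bump i.+1).
  by apply: eq_minor => k /gf.
have e1 : eps p.+1 != 0 by apply: e0; lia.
(* Both products on the right of the three-term relation have the sign [eps p.+2 * eps p.+1], so
   their sum does too; the factor [eps p.+1] cancels. *)
apply: (mulIf e1); rewrite -[minor _ _ _]/(m p.+2 f) Ef -{1}A1 -sgrM.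
rewrite /m three_term; last lia.
by apply: sg_add; rewrite sgrM -/(m _ _) ?B1 ?B2 -/(m _ _) ?A2 ?A3.
Qed.

(** Two passes: arbitrary rows with contiguous columns first; then the same result for the transpose
    of the rows chosen by [f], whose contiguous minors are known from the first pass. *)
Theorem fekete a eps K M N :
  (forall q, (0 < q <= K)%N -> eps q != 0) ->
  (forall q i c, (0 < q <= K)%N -> (i + q <= M)%N -> (c + q <= N)%N ->
     Num.sg (\det (\matrix_(s < q, t < q) a (i + s)%N (c + t)%N)) = eps q) ->
  forall q f g, (0 < q <= K)%N ->
    (forall i j, (i < j < q)%N -> (f i < f j)%N) -> (f q.-1 < M)%N ->
    (forall i j, (i < j < q)%N -> (g i < g j)%N) -> (g q.-1 < N)%N ->
    Num.sg (\det (\matrix_(s < q, t < q) a (f s) (g t))) = eps q.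
Proof.
move=> e0 ha q f g qK fm fM gm gN.
have rows := fekete_rows e0 ha.
pose b i j := a (f j) i.
have := @fekete_rows b eps q N q _ _ q g 0%N; rewrite /minor -det_tr => <- //.
- by congr (Num.sg (\det _)); apply/matrixP=> i j; rewrite !mxE.
- by move=> r rq; apply: e0; lia.
- move=> r i c rq iN cq; rewrite -(rows r (fun k => f (c + k)%N) i); last 1 first.
  + exact: iN.
  + by rewrite /minor -det_tr; congr (Num.sg (\det _)); apply/matrixP=> k l; rewrite !mxE.
  + lia.
  + by move=> k l kl; apply: fm; lia.
  + apply: leq_ltn_trans fM.
    have [->//|ne] := eqVneq (c + r.-1)%N q.-1; apply/ltnW/fm; lia.
- by rewrite leqnn andbT; lia.
Qed.

End Fekete.

(** * Bounds on S^- and S^+, and the sign of a determinant from its test vector *)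

Section VectorSigns.
Variable R : realType.
Local Notation changes := (@qe_rcf_th.changes R).

Lemma size_entries n (x : 'cV[R]_n) : size (entries x) = n.
Proof. by rewrite /entries size_map size_enum_ord. Qed.

Lemma nth_entries n (x : 'cV[R]_n) (i : 'I_n) : (entries x)`_i = x i 0.
Proof. by rewrite (nth_map i) ?size_enum_ord ?nth_ord_enum. Qed.

Lemma has_nonzero_entries n (x : 'cV[R]_n) :
  has (fun a => a != 0) (entries x) = (x != 0).
Proof.
apply/hasP/idP => [[a /mapP[i _ ->]]|/cV0Pn[i xi]].
  by apply: contraNneq => ->; rewrite mxE.
exists (x i 0) => //; apply/mapP; exists i => //; exact: mem_enum.
Qed.

Lemma all_fill_zeros n (y : 'cV[R]_n) s :
  all (fun a => a != 0) (entries (fill_zeros y s)).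
Proof.
apply/allP=> a /mapP[i _ ->]; rewrite mxE.
by case: ifPn => // _; rewrite signr_eq0.
Qed.

Lemma Sminus_leq n (x : 'cV[R]_n) : (Sminus x <= n.-1)%N.
Proof.
apply: leq_trans (changes_size _) _.
rewrite -!subn1 leq_sub2r // size_filter -[X in (_ <= X)%N](size_entries x).
exact: count_size.
Qed.

Lemma fill_changes_leq n (y : 'cV[R]_n) s : (fill_changes y s <= n.-1)%N.
Proof. by rewrite -{2}(size_entries (fill_zeros y s)) changes_size. Qed.

Lemma Splus_leq n (y : 'cV[R]_n) : y != 0 -> (Splus y <= n.-1)%N.
Proof. by move=> /Splus_attained[s <-]; apply: fill_changes_leq. Qed.

Lemma Splus_leq_size n (y : 'cV[R]_n) : (Splus y <= n)%N.
Proof.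
have [->|/Splus_leq] := eqVneq y 0; first by rewrite /Splus eqxx.
by move=> h; apply: leq_trans h (leq_pred n).
Qed.

Lemma fill_changes_Splus n (y : 'cV[R]_n) s :
  y != 0 -> (fill_changes y s <= Splus y)%N.
Proof. by move=> /negbTE y0; rewrite /Splus y0; apply: leq_bigmax. Qed.

Lemma changes_alternating (e : R) (w : seq R) : e != 0 ->
  (forall i, (i < size w)%N -> Num.sg w`_i = e * (-1) ^+ i) ->
  changes w = (size w).-1.
Proof.
elim: w e => //= a [|b w] IH e e0 aw; first by rewrite /= mulr0 ltxx.
rewrite (IH (- e)) ?oppr_eq0 //=; last first.
  by move=> i iw; have := aw i.+1 iw => /= ->; rewrite exprS mulrA mulrN1.
have := aw 0%N isT; have := aw 1%N isT; rewrite /= mulr1 => sb sa.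
have e1 : e ^+ 2 != 0 by rewrite expf_neq0.
rewrite -sgr_lt0 sgrM sa sb expr1 mulrN1 mulrN -expr2 oppr_lt0.
by rewrite exprn_even_gt0 //= e0 add1n.
Qed.

Section AlternatingVector.
Variables (k : nat) (alpha : 'cV[R]_k.+1) (d : R).
Hypotheses (alpha_ge0 : forall a, 0 <= alpha a 0) (d_neq0 : d != 0).

(** The assignment that makes [d *: alternate alpha] strictly alternating, starting with the sign of
    [d]. *)
Definition alt_fill : {ffun 'I_k.+1 -> bool} := [ffun a : 'I_k.+1 => (d < 0) (+) odd a].

Lemma sg_alt_fill (a : 'I_k.+1) :
  Num.sg (fill_zeros (d *: alternate alpha) alt_fill a 0) =
  Num.sg d * (-1) ^+ a.
Proof.
have sd : (-1) ^+ (d < 0)%R = Num.sg d.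
  by case: (sgrP d) d_neq0 => //; rewrite ?eqxx.
rewrite !mxE !mulf_eq0 signr_eq0 (negbTE d_neq0) /=.
have [_|a0] := eqVneq (alpha a 0) 0.
  by rewrite ffunE signr_addb sd signr_odd sgrM sgr_id sgrX sgrN sgr1.
rewrite !sgrM sgrX sgrN sgr1 [Num.sg (alpha a 0)]gtr0_sg ?mulr1 //.
by rewrite lt0r a0 alpha_ge0.
Qed.

Lemma alt_fill_changes : fill_changes (d *: alternate alpha) alt_fill = k.
Proof.
rewrite /fill_changes (@changes_alternating (Num.sg d)) ?sgr_eq0 ?size_entries //.
by move=> i ik; rewrite (nth_entries _ (Ordinal ik)) sg_alt_fill.
Qed.

Lemma Splus_alternating : alternate alpha != 0 ->
  Splus (d *: alternate alpha) = k.
Proof.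
move=> v0; have y0 : d *: alternate alpha != 0 by rewrite scaler_eq0 negb_or d_neq0.
apply/eqP; rewrite eqn_leq (leq_trans (Splus_leq y0)) //=.
by apply: leq_trans (fill_changes_Splus alt_fill y0); rewrite alt_fill_changes.
Qed.

End AlternatingVector.

(** By convention S^+(0) is the dimension n + 1, whereas S^- is at most n. *)
Lemma mulmx_neq0_of_Splus n (x : 'cV[R]_n.+1) (M : 'M[R]_n.+1) :
  (Splus (M *m x) <= Sminus x)%N -> M *m x != 0.
Proof.
apply: contraTneq => y0; rewrite /Splus y0 eqxx -ltnNge ltnS.
exact: Sminus_leq.
Qed.

(* The adjugate turns the alternating vector into a vector whose first entry is
   a nonnegative combination of minors of order k, and A x = det(A) v. *)
Lemma sg_det_of_test_vector k (A : 'M[R]_k.+1) (alpha : 'cV[R]_k.+1) eps :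
  let x := \adj A *m alternate alpha in
  (forall a, 0 <= alpha a 0) -> alternate alpha != 0 ->
  eps k * eps k = 1 ->
  (forall l, Num.sg (\det (row' l (col' ord0 A))) = eps k) ->
  (Splus (A *m x) <= Sminus x)%N ->
  (forall r : nat, Splus (A *m x) = r -> Sminus x = r -> (r <= k)%N ->
     end_signs_agree (eps r * eps r.+1) (A *m x) x) ->
  Num.sg (\det A) = eps k.+1.
Proof.
move=> x a0 v0 ek minors Sle Seq.
have y0 := mulmx_neq0_of_Splus Sle.
have yE : A *m x = \det A *: alternate alpha.
  by rewrite mulmxA mul_mx_adj mul_scalar_mx.
move: y0 Sle Seq; rewrite yE scaler_eq0 negb_or => /andP[d0 _].
rewrite Splus_alternating // => kle Seq.
have Sx : Sminus x = k by apply/eqP; rewrite eqn_leq kle Sminus_leq.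
have [|hd _] := Seq k erefl Sx (leqnn k) (alt_fill k (\det A)).
  by rewrite alt_fill_changes ?Splus_alternating.
have x0 : has (fun a => a != 0) (entries x).
  rewrite has_nonzero_entries; apply: contraNneq d0 => x0.
  have /eqP : \det A *: alternate alpha = 0 by rewrite -yE x0 mulmx0.
  by rewrite scaler_eq0 (negbTE v0) orbF.
(* k changes need k + 1 non-zero entries, so the first non-zero entry of [x] is its first entry. *)
have nzE : nonzero_entries x = entries x.
  apply/all_filterP; rewrite all_count size_entries.
  have := count_size (fun a => a != 0) (entries x).
  have := changes_size (nonzero_entries x); rewrite -/(Sminus x) Sx.
  move: x0; rewrite has_count /nonzero_entries size_filter size_entries.
  by move: (count _ _) => c; lia.
move: hd; rewrite nzE -!nth0.
rewrite (nth_entries _ (@ord0 k)) (nth_entries x (@ord0 k)).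
rewrite sg_alt_fill // mulr1 => ->.
suff -> : Num.sg (x ord0 0) = eps k by rewrite mulrAC ek mul1r.
have ep : eps k != 0 by apply/eqP => e; move/eqP: ek; rewrite e mul0r eq_sym oner_eq0.
(* The cofactor signs cancel against the alternating signs of the vector. *)
have xE : eps k * x ord0 0 = \sum_l alpha l 0 * (eps k * \det (row' l (col' ord0 A))).
  rewrite mxE mulr_sumr; apply: eq_bigr => l _; rewrite !mxE /cofactor addn0.
  have := sqrr_sign R l; move: (_ ^+ l : R) (\det _) => u D uu.
  by rewrite -[alpha l 0 in RHS]mul1r -uu; ring.
have pos l : 0 < eps k * \det (row' l (col' ord0 A)).
  rewrite -sgr_gt0 sgrM minors -(minors l) sgr_id minors ek //.
have : 0 < eps k * x ord0 0.
  have /cV0Pn[l al] := v0; rewrite xE (bigD1 l) //= ltr_pwDl //.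
    rewrite mulr_gt0 // lt0r a0 andbT.
    by apply: contraNneq al; rewrite mxE => ->; rewrite mulr0.
  by apply: sumr_ge0 => i _; rewrite mulr_ge0 // ltW.
rewrite -sgr_gt0 sgrM -(minors ord0) sgr_id.
move: (\det _) (x ord0 0) => u v.
by case: (sgrP u) => _; case: (sgrP v) => _;
  rewrite ?mul0r ?mulr0 ?mul1r ?mulr1 ?ltxx ?ltr0N1.
Qed.

End VectorSigns.

(** * From test vectors to strict sign regularity: (3) => (1) *)

Section Contiguous.
Variables (R : realType) (m n : nat) (A : 'M[R]_(m.+1, n.+1)) (eps : nat -> R).
Let a i j := A (inord i) (inord j).

Lemma contig_subE k i j (hi : (i + k <= m.+1)%N) (hj : (j + k <= n.+1)%N) :
  contig_sub hi hj A = \matrix_(s < k, t < k) a (i + s) (j + t).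
Proof.
apply/matrixP=> s t; rewrite !mxE /a; congr (A _ _); apply/val_inj => /=.
  by rewrite inordK // (leq_trans _ hi) // -addnS leq_add2l.
by rewrite inordK // (leq_trans _ hj) // -addnS leq_add2l.
Qed.

Lemma SSR_of_contig :
  (forall r, (1 <= r <= minn m.+1 n.+1)%N -> eps r != 0) ->
  (forall k i j (hi : (i + k <= m.+1)%N) (hj : (j + k <= n.+1)%N),
     (1 <= k)%N -> Num.sg (\det (contig_sub hi hj A)) = eps k) ->
  SSR eps A.
Proof.
move=> e0 h r f g rmn; case: r rmn f g => // r rmn f g fm gm.
suff E : Num.sg (\det (mxsub f g A)) = eps r.+1.
  by split=> //; rewrite -sgr_eq0 E e0.
rewrite -(@fekete R a eps (minn m.+1 n.+1) m.+1 n.+1 e0 _ r.+1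
  (fun k => f (inord k)) (fun k => g (inord k))) //.
- congr (Num.sg (\det _)); apply/matrixP=> i j; rewrite !mxE /a !inord_val //.
- by move=> q i c /andP[q0 _] hi hj; rewrite -(h q i c hi hj q0) contig_subE.
- by move=> i j /andP[ij jr]; apply: fm; rewrite !inordK //; lia.
- by move=> i j /andP[ij jr]; apply: gm; rewrite !inordK //; lia.
Qed.

Lemma SSR_of_test_vectors (alpha : forall k i j : nat, 'cV[R]_k) :
  eps 0%N = 1 ->
  (forall r : nat, (1 <= r <= minn m.+1 n.+1)%N -> eps r = 1 \/ eps r = -1) ->
  (forall k i j : nat,
     (1 <= k)%N -> (i + k <= m.+1)%N -> (j + k <= n.+1)%N ->
     (forall a : 'I_k, 0 <= alpha k i j a 0) /\ alternate (alpha k i j) != 0) ->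
  (forall (k i j : nat) (hi : (i + k <= m.+1)%N) (hj : (j + k <= n.+1)%N),
    (1 <= k)%N ->
    let Ak := contig_sub hi hj A in
    let x := \adj Ak *m alternate (alpha k i j) in
    (Splus (Ak *m x) <= Sminus x)%N /\
    (forall r : nat, Splus (Ak *m x) = r -> Sminus x = r ->
       (r <= k - 1)%N ->
       end_signs_agree (eps r * eps r.+1) (Ak *m x) x)) ->
  SSR eps A.
Proof.
move=> eps0 epsP alphaP h.
have e2 r : (r <= minn m.+1 n.+1)%N -> eps r * eps r = 1.
  case: r => [|r] rmn; first by rewrite eps0 mulr1.
  by have [->|->] := epsP r.+1 rmn; rewrite ?mulrNN mulr1.
have e0 r : (r <= minn m.+1 n.+1)%N -> eps r != 0.
  by move=> /e2 e; apply: contra_eqN e => /eqP ->; rewrite mul0r eq_sym oner_eq0.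
apply: SSR_of_contig => [r /andP[_ /e0]//|].
elim/ltn_ind => -[//|k] IH i j hi hj _.
have [hS hE] := h _ _ _ hi hj isT.
have [a0 v0] := alphaP k.+1 i j isT hi hj.
have kmn : (k.+1 <= minn m.+1 n.+1)%N.
  by rewrite leq_min; apply/andP; split; lia.
apply: (sg_det_of_test_vector a0 v0) => //; first by apply: e2; apply: ltnW.
  (* Deleting row [l] may break contiguity, so Fekete's argument is applied to the contiguous minors
     of order at most k, known by induction. For k = 0 the minor is empty and [eps 0] is 1. *)
  move=> l; have [k0|k0] := posnP k.
    move: (row' _ _) => M; suff -> : \det M = 1 by rewrite sgr1 k0 eps0.
    by move: M; rewrite /= k0 => M; apply: det_mx00.
  rewrite -(@fekete R a eps k m.+1 n.+1 _ _ k
    (fun s => i + bump l s)%N (fun t => j + bump 0 t)%N) ?leqnn ?andbT //.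
  - congr (Num.sg (\det _)); apply/matrixP=> s t.
    by rewrite contig_subE !mxE.
  - by move=> q /andP[_ qk]; apply: e0; lia.
  - move=> q s t /andP[q0 qk] hs ht.
    by rewrite -(IH q _ s t hs ht) // contig_subE.
  - by move=> s t st; rewrite ltn_add2l /bump; lia.
  - by apply: leq_trans (hi); rewrite /= /bump; lia.
  - by move=> s t st; rewrite ltn_add2l /bump; lia.
  - by apply: leq_trans (hj); rewrite /= /bump; lia.
by move=> r h1 h2 rk; apply: hE => //; rewrite subn1.
Qed.

End Contiguous.

(** * Sign blocks of a vector and alternating chains of entries *)

Section Blocks.
Variable R : realType.

Lemma sg_eq_of_sqr1 (e u : R) : e * e = 1 -> (Num.sg u == e) = (0 < e * u).
Proof.
rewrite -expr2 => /eqP; rewrite sqrf_eq1 => /orP[] /eqP ->.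
  by rewrite sgr_cp0 mul1r.
by rewrite sgr_cp0 mulN1r oppr_gt0.
Qed.

Lemma vector_blocks n (x : 'cV[R]_n) : x != 0 ->
  exists b : nat -> nat,
  [/\ {homo b : i j / (i <= j)%N},
      forall i, (b i <= Sminus x)%N,
      forall i : 'I_n, x i 0 =
        `|x i 0| * (Num.sg (head 0 (nonzero_entries x)) * (-1) ^+ b i)
    & forall q, (q <= Sminus x)%N -> exists2 i : 'I_n, x i 0 != 0 & b i = q].
Proof.
rewrite -has_nonzero_entries => /sign_blocks[b [bm bc bs bt]].
exists b; split=> // [i|q /bt[i xi bi]].
  have [->|xi] := eqVneq (x i 0) 0; first by rewrite normr0 mul0r.
  by rewrite -bs nth_entries // mulrC -numEsg.
have ip : (i < n)%N.
  by rewrite ltnNge; apply: contra xi => ni; rewrite nth_default ?size_entries.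
by exists (Ordinal ip) => //; rewrite -nth_entries.
Qed.

(** One index is taken from each of the first q + 1 sign blocks of the filled vector. The inequality
    is weak because the entry of [y] there may be a filled zero. *)
Lemma fill_chain m (y : 'cV[R]_m) s q : (0 < m)%N -> (q <= fill_changes y s)%N ->
  exists2 f : 'I_q.+1 -> 'I_m, {homo f : i j / (i < j)%N} &
    forall l : 'I_q.+1,
      0 <= Num.sg (head 0 (entries (fill_zeros y s))) * (-1) ^+ l * y (f l) 0.
Proof.
move=> m0; rewrite /fill_changes; set w := fill_zeros y s => qw.
have nzE : [seq a <- entries w | a != 0] = entries w.
  exact/all_filterP/all_fill_zeros.
have w0 : has (fun a => a != 0) (entries w).
  by rewrite has_filter nzE -size_eq0 size_entries -lt0n.
have := sign_blocks w0; rewrite nzE => -[b [bm _ bs bt]].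
have /fin_all_exists[f fP] (l : 'I_q.+1) :
    exists i : 'I_m, (entries w)`_i != 0 /\ b i = l.
  have [|i wi bi] := bt l; first by apply: leq_trans qw; rewrite -ltnS.
  have ip : (i < m)%N.
    by rewrite ltnNge; apply: contra wi => ni; rewrite nth_default ?size_entries.
  by exists (Ordinal ip).
exists f => [i j ij|l].
  rewrite ltnNge; apply/negP => /bm; case: (fP i) => _ ->; case: (fP j) => _ ->.
  by rewrite leqNgt ij.
have [wl bl] := fP l; rewrite -bl -bs // nth_entries mxE.
by case: eqP => [->|_]; rewrite ?mulr0 // -normrEsg.
Qed.

Lemma lift_homo n (h : 'I_n) : {homo lift h : i j / (i < j)%N}.
Proof. by move=> i j /= ij; rewrite /bump; lia. Qed.

End Blocks.

(** * Variation diminution for strictly sign regular matrices: (1) => (2) *)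

Section VariationDiminishing.
Variables (R : realType) (m n : nat) (A : 'M[R]_(m, n)) (eps : nat -> R).
Hypotheses (ssr : SSR eps A) (eps0 : eps 0%N = 1).
Hypothesis epsP : forall r, (r <= minn m n)%N -> eps r * eps r = 1.
Variables (x : 'cV[R]_n) (x_neq0 : x != 0) (p_lt_m : (Sminus x < m)%N).
Let p := Sminus x.
Let sigma := Num.sg (head 0 (nonzero_entries x)).
Let y := A *m x.

Lemma Sminus_ltn_cols : (p < n)%N.
Proof.
have n0 : (0 < n)%N by have /cV0Pn[i _] := x_neq0; apply: leq_ltn_trans (ltn_ord i).
by rewrite -(prednK n0) ltnS Sminus_leq.
Qed.

(** Column t of [Y] sums the columns of [A] over block t with weights the absolute values of [x];
    [d] keeps the signs. By Cauchy-Binet a minor of [Y] is a nonnegative combination of minors of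
    [A] of the same order. *)
Lemma block_sums :
  exists (Y : 'M[R]_(m, p.+1)) (d : 'cV[R]_p.+1),
  [/\ y = Y *m d, forall t, d t 0 = sigma * (-1) ^+ t
    & forall q (f : 'I_q -> 'I_m) (g : 'I_q -> 'I_p.+1), (q <= p.+1)%N ->
        {homo f : i j / (i < j)%N} -> {homo g : i j / (i < j)%N} ->
        Num.sg (\det (mxsub f g Y)) = eps q].
Proof.
have [b [bm bc bx bt]] := vector_blocks x_neq0.
pose E : 'M[R]_(n, p.+1) := \matrix_(j, t) (`|x j 0| *+ (b j == t)).
pose d : 'cV[R]_p.+1 := \col_t (sigma * (-1) ^+ t).
exists (A *m E), d; split=> [|t|q f g qp fm gm].
- rewrite -mulmxA; congr (_ *m _); apply/colP => j; rewrite mxE.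
  have bj : (b j < p.+1)%N by rewrite ltnS.
  rewrite (bigD1 (Ordinal bj)) //= big1 => [|t tj]; last first.
    by rewrite mxE -(inj_eq val_inj) /= eq_sym in tj *; rewrite (negbTE tj) mul0r.
  by rewrite !mxE eqxx addr0 mulr1n -bx.
- by rewrite mxE.
have /fin_all_exists[h hP] (t : 'I_p.+1) : exists j : 'I_n, x j 0 != 0 /\ b j = t.
  by have [|j xj bj] := bt t; [rewrite -ltnS|exists j].
have pn := Sminus_ltn_cols.
have qmn : (q <= minn m n)%N by rewrite leq_min !(leq_trans qp).
have posdet (phi : 'I_q -> 'I_n) : {homo phi : i j / (i < j)%N} ->
    0 < eps q * \det (mxsub f phi A).
  (* Order 0 does occur: for p = 0, Cramer's rule below uses empty minors. *)
  move=> phim; case: q => [|q] in f g qp fm gm qmn phi phim *.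
    by rewrite det_mx00 mulr1 eps0.
  have [] := ssr _ fm phim; first by rewrite qmn.
  by rewrite -sg_eq_of_sqr1 ?epsP // => _ ->.
apply/eqP; rewrite sg_eq_of_sqr1 ?epsP //.
have -> : mxsub f g (A *m E) = mxsub f id A *m mxsub id g E.
  by apply/matrixP=> i j; rewrite !mxE; apply: eq_bigr => k _; rewrite !mxE.
rewrite det_mul_expand mulr_sumr.
(* A non-zero weight forces [phi c] into block [g c]; since blocks follow one another, [phi] is
   increasing. *)
have term (phi : {ffun 'I_q -> 'I_n}) :
    \prod_c mxsub id g E (phi c) c != 0 -> 
    0 < eps q * (\prod_c mxsub id g E (phi c) c * \det (mxsub id phi (mxsub f id A))).
  move=> nz; have bg c : b (phi c) = g c.
    move/prodf_neq0: nz => /(_ c isT).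
    by rewrite !mxE; case: (b (phi c) =P g c) => //= _; rewrite mulr0n eqxx.
  have phim : {homo phi : i j / (i < j)%N}.
    move=> i j ij; rewrite ltnNge; apply/negP => /bm; rewrite !bg.
    by rewrite leqNgt gm.
  have -> : mxsub id phi (mxsub f id A) = mxsub f phi A.
    by apply/matrixP=> i j; rewrite !mxE.
  rewrite mulrCA mulr_gt0 ?posdet // lt0r nz.
  by apply: prodr_ge0 => c _; rewrite !mxE mulrn_wge0.
(* [h] selects a non-zero coordinate of [x] in each block, so this term is strictly positive. *)
rewrite (bigD1 [ffun c => h (g c)]) //= ltr_pwDl //.
  apply: term; apply/prodf_neq0 => c _; rewrite !mxE ffunE.
  by case: (hP (g c)) => xh ->; rewrite eqxx normr_eq0.
apply: sumr_ge0 => phi _; have [->|/term/ltW//] := eqVneq (\prod_c mxsub id g E (phi c) c) 0.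
by rewrite mul0r mulr0.
Qed.

Lemma sigma_neq0 : sigma != 0.
Proof.
rewrite sgr_eq0; have := x_neq0; rewrite -has_nonzero_entries has_filter.
rewrite -/(nonzero_entries x); have := filter_all (fun a => a != 0) (entries x).
by rewrite -/(nonzero_entries x); case: (nonzero_entries x) => //= a s /andP[].
Qed.

Lemma det_neq0_mulmx_eq0 q (V : 'M[R]_q) (d : 'cV[R]_q) :
  \det V != 0 -> V *m d = 0 -> d = 0.
Proof.
by move=> dV Vd; rewrite -[d](@mulKmx _ _ _ V) ?Vd ?mulmx0 // unitmxE unitfE.
Qed.

Lemma Splus_of_SSR : y != 0 /\ (Splus y <= p)%N.
Proof.
have [Y [d [yE dE minors]]] := block_sums.
have d0 : d != 0.
  apply: contraNneq sigma_neq0 => d0.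
  by have := dE ord0; rewrite d0 mxE mulr1 => <-.
have e2 : eps p.+1 * eps p.+1 = 1 by rewrite epsP // leq_min p_lt_m Sminus_ltn_cols.
have rows_neq0 (f : 'I_p.+1 -> 'I_m) : {homo f : i j / (i < j)%N} ->
    exists i, y (f i) 0 != 0.
  move=> fm; have dV : \det (mxsub f id Y) != 0.
    rewrite -sgr_eq0 minors //.
    by apply: contra_eqN e2 => /eqP ->; rewrite mul0r eq_sym oner_eq0.
  apply/existsP; apply: contraNT d0; rewrite negb_exists => /forallP y0.
  apply/eqP/(det_neq0_mulmx_eq0 dV)/colP => i.
  have /negPn/eqP := y0 i; rewrite yE !mxE => yi; rewrite -[RHS]yi.
  by apply: eq_bigr => j _; rewrite !mxE.
have y0 : y != 0.
  have [//|i yi] := rows_neq0 (widen_ord p_lt_m).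
  by apply/cV0Pn; exists (widen_ord p_lt_m i).
split=> //; have [s sy] := Splus_attained y0; rewrite -sy leqNgt; apply/negP => ps.
have [//|f fm fpos] := fill_chain _ ps; first exact: leq_ltn_trans p_lt_m.
set th := Num.sg _ in fpos.
pose V := mxsub f id Y.
have Vd l : (V *m d) l 0 = y (f l) 0.
  by rewrite yE !mxE; apply: eq_bigr => j _; rewrite !mxE.
have minpos l : 0 < eps p.+1 * \det (row' l V).
  rewrite -sg_eq_of_sqr1 //; have -> : row' l V = mxsub (f \o lift l) id Y.
    by apply/matrixP=> i j; rewrite !mxE.
  by apply/eqP/minors => // i j ij; apply/fm/lift_homo.
have th0 : th != 0.
  rewrite /th sgr_eq0; have := all_fill_zeros y s.
  case E: (entries _) => [|a w] /=; last by case/andP.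
  by have := size_entries (fill_zeros y s); rewrite E => /= m0; move: p_lt_m; rewrite -m0.
have t0 (l : 'I_p.+2) : 0 <= th * (-1) ^+ l * y (f l) 0 * (eps p.+1 * \det (row' l V)).
  by rewrite mulr_ge0 ?fpos // ltW.
(* The relation between the maximal minors of [V], scaled by [th * eps p.+1]. Its terms are
   nonnegative, so [y] vanishes on all p + 2 rows, although any p + 1 rows of [Y] form an invertible
   matrix. *)
have /eqP : \sum_(l < p.+2) th * (-1) ^+ l * y (f l) 0 * (eps p.+1 * \det (row' l V)) = 0.
  have := congr1 ( *%R (th * eps p.+1)) (maximal_minors_mul V d).
  rewrite mulr0 mulr_sumr; apply: etrans; apply: eq_bigr => l _.
  by rewrite Vd; move: (\det _) => D; ring.
rewrite psumr_eq0 // => /allP sum0.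
have yf0 l : y (f l) 0 = 0.
  apply/eqP; have := sum0 l (mem_index_enum _).
  by rewrite !mulf_eq0 signr_eq0 (negbTE th0) /= -mulf_eq0 (gt_eqF (minpos l)) orbF.
have [|i] := rows_neq0 (f \o lift ord0); last by rewrite yf0 eqxx.
by move=> i j ij; apply/fm/lift_homo.
Qed.

Lemma end_signs_of_SSR : Splus y = p -> end_signs_agree (eps p * eps p.+1) y x.
Proof.
move=> Sy s; rewrite Sy => sy.
have [Y [d [yE dE minors]]] := block_sums.
have [//||f fm] := @fill_chain _ _ y s p; first exact: leq_ltn_trans p_lt_m.
  by rewrite sy.
(* Both sequences have p changes, so the claim on last signs follows from the one on first signs. *)
rewrite (sg_last (all_fill_zeros y s)) sg_last ?filter_all //.
rewrite -/(fill_changes y s) -/(Sminus x) sy -/p -/sigma.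
set th := Num.sg _ => fpos.
have th0 : th != 0.
  rewrite /th sgr_eq0; have := all_fill_zeros y s.
  case E: (entries _) => [|a w] /=; last by case/andP.
  by have := size_entries (fill_zeros y s); rewrite E => /= m0; move: p_lt_m; rewrite -m0.
have th2 : th * th = 1.
  by move: th0; rewrite -expr2 /th sgr_eq0 sqr_sg => ->.
have si2 : sigma * sigma = 1.
  by have := sigma_neq0; rewrite -expr2 /sigma sgr_eq0 sqr_sg => ->.
have e2 : eps p * eps p = 1 by rewrite epsP // ltnW // leq_min p_lt_m Sminus_ltn_cols.
pose V := mxsub f id Y.
have Vd l : (V *m d) l 0 = y (f l) 0.
  by rewrite yE !mxE; apply: eq_bigr => j _; rewrite !mxE.
have detV : Num.sg (\det V) = eps p.+1 by apply: minors.
have dV : \det V != 0.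
  have e2' : eps p.+1 * eps p.+1 = 1 by rewrite epsP // leq_min p_lt_m Sminus_ltn_cols.
  by rewrite -sgr_eq0 detV; apply: contra_eqN e2' => /eqP ->; rewrite mul0r eq_sym oner_eq0.
have minpos l : 0 < eps p * \det (row' l (col' ord0 V)).
  rewrite -sg_eq_of_sqr1 //.
  have -> : row' l (col' ord0 V) = mxsub (f \o lift l) (lift ord0) Y.
    by apply/matrixP=> i j; rewrite !mxE.
  apply/eqP/minors => //.
  by move=> i j ij; apply/fm/lift_homo.
(* First coordinate of [\adj V *m (V *m d) = \det V *: d], scaled by [eps p * th]. The right side is
   nonnegative and the left side non-zero, which fixes the sign of [\det V]. *)
have cramer : (eps p * th * sigma) * \det V =
    \sum_(l < p.+1) (eps p * \det (row' l (col' ord0 V))) * (th * (-1) ^+ l * y (f l) 0).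
  have := congr1 (fun M : 'cV_p.+1 => M ord0 0) (mulmxA (\adj V) V d).
  rewrite mul_adj_mx mul_scalar_mx mxE [in RHS]mxE dE mulr1 => adjE.
  transitivity (eps p * th * (\det V * sigma)); first by ring.
  rewrite -adjE mulr_sumr; apply: eq_bigr => l _.
  by rewrite -Vd [(\adj V) _ _]mxE /cofactor addn0; move: (\det _) (_ l 0) => D z; ring.
have : 0 < eps p * th * sigma * \det V.
  have th1 : eps p * th * sigma * (eps p * th * sigma) = 1.
    by transitivity ((eps p * eps p) * (th * th) * (sigma * sigma)); [ring|rewrite e2 th2 si2 !mulr1].
  rewrite lt0r mulf_neq0 //=; last first.
    by apply: contra_eqN th1 => /eqP ->; rewrite mul0r eq_sym oner_eq0.
  by rewrite cramer; apply: sumr_ge0 => l _; rewrite mulr_ge0 ?fpos // ltW.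
rewrite -sg_eq_of_sqr1; last first.
  by transitivity ((eps p * eps p) * (th * th) * (sigma * sigma)); [ring|rewrite e2 th2 si2 !mulr1].
rewrite detV => /eqP ->.
have -> : eps p * (eps p * th * sigma) * sigma = th.
  by transitivity ((eps p * eps p) * th * (sigma * sigma)); [ring|rewrite e2 si2 mul1r mulr1].
split=> //; rewrite [RHS]mulrA; congr (_ * _).
by transitivity ((eps p * eps p) * th * (sigma * sigma)); [rewrite e2 si2 mul1r mulr1|ring].
Qed.

End VariationDiminishing.

(** * Windows of consecutive coordinates: restriction and extension by zero *)

Section Window.
Variables (R : realType) (m k i : nat) (hi : (i + k <= m)%N).
Local Notation changes := (@qe_rcf_th.changes R).

Definition window_ord (s : 'I_k) : 'I_m := widen_ord hi (rshift i s).

Lemma window_ord_inj : injective window_ord.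
Proof. by move=> s t /(congr1 val) /= /addnI st; apply/val_inj. Qed.

Lemma entries_window (y : 'cV[R]_m) :
  entries y = take i (entries y) ++ entries (rowsub window_ord y)
    ++ drop (i + k) (entries y).
Proof.
suff -> : entries (rowsub window_ord y) = take k (drop i (entries y)).
  by rewrite addnC -drop_drop !cat_take_drop.
have sz : size (take k (drop i (entries y))) = k.
  by rewrite size_takel // size_drop size_entries; lia.
apply: (@eq_from_nth _ 0); rewrite ?sz size_entries // => s sk.
rewrite (nth_entries _ (Ordinal sk)) nth_take // nth_drop !mxE.
by rewrite -nth_entries.
Qed.

Section Embedding.
Variable x : 'cV[R]_k.

(** Extension by zero, written as a product so that multiplying a matrix by it selects columns. *)
Definition embed : 'cV[R]_m := colsub window_ord 1%:M *m x.

Lemma rowsub_embed : rowsub window_ord embed = x.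
Proof.
apply/colP=> s; rewrite !mxE (bigD1 s) //= big1 => [|t ts].
  by rewrite !mxE eqxx mul1r addr0.
by rewrite !mxE (inj_eq window_ord_inj) eq_sym (negbTE ts) mul0r.
Qed.

Lemma embed_outside (c : 'I_m) : (forall s, c != window_ord s) -> embed c 0 = 0.
Proof.
by move=> cs; rewrite mxE big1 // => s _; rewrite !mxE (negbTE (cs s)) mul0r.
Qed.

Lemma nonzero_entries_embed : nonzero_entries embed = nonzero_entries x.
Proof.
have nil0 (w : seq R) : (forall c, (c < size w)%N -> w`_c = 0) ->
    [seq a <- w | a != 0] = [::].
  elim: w => //= a w IH w0; have /= -> := w0 0%N isT.
  rewrite eqxx IH // => c cw.
  exact: (w0 c.+1).
rewrite /nonzero_entries (entries_window embed) rowsub_embed !filter_cat.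
rewrite nil0 => [|c]; last first.
  rewrite size_take size_entries => ci.
  have cm : (c < m)%N by move: ci; case: ifP; lia.
  have {}ci : (c < i)%N by move: ci; case: ifP; lia.
  rewrite nth_take // (nth_entries _ (Ordinal cm)) embed_outside // => s.
  by rewrite -val_eqE /=; lia.
rewrite (nil0 (drop _ _)) ?cats0 // => c; rewrite size_drop size_entries => cm.
have cm' : (i + k + c < m)%N by lia.
rewrite nth_drop (nth_entries _ (Ordinal cm')) embed_outside // => s.
by rewrite -val_eqE /=; have := ltn_ord s; lia.
Qed.

Lemma Sminus_embed : Sminus embed = Sminus x.
Proof. by rewrite /Sminus nonzero_entries_embed. Qed.

End Embedding.

Section Filling.
Variables (y : 'cV[R]_m) (s : {ffun 'I_k -> bool}).

(** Zeros outside the window get the value 1 whatever [s] is, so two extensions differ only inside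
    the window. *)
Definition extend_fill : {ffun 'I_m -> bool} :=
  [ffun c => [exists t, (c == window_ord t) && s t]].

Lemma extend_fill_outside (c : 'I_m) : (forall t, c != window_ord t) ->
  extend_fill c = false.
Proof.
by move=> ct; rewrite ffunE; apply/existsP => -[t]; rewrite (negbTE (ct t)).
Qed.

Lemma rowsub_fill_zeros : rowsub window_ord (fill_zeros y extend_fill) =
  fill_zeros (rowsub window_ord y) s.
Proof.
apply/colP => t; rewrite !mxE ffunE; case: eqP => // _; congr (_ ^+ nat_of_bool _).
apply/existsP/idP => [[t' /andP[/eqP/window_ord_inj ->]]//|st].
by exists t; rewrite eqxx.
Qed.

Hypothesis k_gt0 : (0 < k)%N.

Let fill_neq_nil : entries (fill_zeros (rowsub window_ord y) s) != [::].
Proof. by rewrite -size_eq0 size_entries -lt0n. Qed.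

Lemma fill_changes_window :
  (fill_changes (rowsub window_ord y) s <= fill_changes y extend_fill)%N.
Proof.
rewrite /fill_changes (entries_window (fill_zeros y _)) rowsub_fill_zeros.
exact: changes_infix.
Qed.

Lemma fill_ends_window :
  fill_changes y extend_fill = fill_changes (rowsub window_ord y) s ->
  Num.sg (head 0 (entries (fill_zeros y extend_fill))) =
    Num.sg (head 0 (entries (fill_zeros (rowsub window_ord y) s))) /\
  Num.sg (last 0 (entries (fill_zeros y extend_fill))) =
    Num.sg (last 0 (entries (fill_zeros (rowsub window_ord y) s))).
Proof.
have := all_fill_zeros y extend_fill.
rewrite /fill_changes (entries_window (fill_zeros y _)) rowsub_fill_zeros.
exact: changes_infix_ends.
Qed.

End Filling.

(* Alternating the signs of the zeros inside the window gives k - 1 changes,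
   and of the two such choices one makes a further change at the border. *)
Lemma Splus_zero_window (y : 'cV[R]_m) : (0 < k)%N -> y != 0 ->
  rowsub window_ord y = 0 -> (k <= Splus y)%N.
Proof.
move=> k0 y0 u0; rewrite leqNgt; apply/negP => Sk.
pose s (b : bool) : {ffun 'I_k -> bool} := [ffun t : 'I_k => b (+) odd t].
have sgs b (t : 'I_k) : Num.sg (fill_zeros (rowsub window_ord y) (s b) t 0) =
    (-1) ^+ b * (-1) ^+ t.
  by rewrite u0 !mxE eqxx ffunE signr_addb signr_odd sgrM !sgrX sgrN sgr1.
have chs b : fill_changes (rowsub window_ord y) (s b) = k.-1.
  rewrite /fill_changes (@changes_alternating _ ((-1) ^+ b)) ?signr_eq0 ?size_entries //.
  by move=> t tk; rewrite (nth_entries _ (Ordinal tk)) sgs.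
have ends b := @fill_ends_window y (s b) k0.
(* As S^+(y) < k, neither extension changes sign outside the window, so the ends of [y] inherit the
   end signs of the window, which are opposite for the two choices. *)
have {}ends b : 
  Num.sg (head 0 (entries (fill_zeros y (extend_fill (s b))))) = (-1) ^+ b /\
  Num.sg (last 0 (entries (fill_zeros y (extend_fill (s b))))) = 
    (-1) ^+ b * (-1) ^+ k.-1.
  have [|-> ->] := ends b.
    apply/eqP; rewrite eqn_leq fill_changes_window // andbT chs.
    by apply: leq_trans (fill_changes_Splus _ y0) _; lia.
  rewrite -nth0 -nth_last size_entries.
  rewrite (nth_entries _ (Ordinal k0)) sgs mulr1; split=> //.
  have kk : (k.-1 < k)%N by rewrite prednK.
  by rewrite (nth_entries _ (Ordinal kk)) sgs.
have [[c yc] ] : (exists c, y c 0 != 0) /\ true by split=> //; apply/cV0Pn.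
have cout t : c != window_ord t.
  by apply: contraNneq yc => ->; have /colP/(_ t) := u0; rewrite !mxE => ->.
have m0 : (0 < m)%N by apply: leq_ltn_trans (ltn_ord c).
have m1 : (m.-1 < m)%N by rewrite prednK.
have eq_out (c' : 'I_m) : (forall t, c' != window_ord t) ->
    fill_zeros y (extend_fill (s true)) c' 0 =
    fill_zeros y (extend_fill (s false)) c' 0.
  by move=> c'o; rewrite !mxE !extend_fill_outside.
have signE b : Num.sg (fill_zeros y (extend_fill (s b)) (Ordinal m0) 0) = (-1) ^+ b /\
    Num.sg (fill_zeros y (extend_fill (s b)) (Ordinal m1) 0) = (-1) ^+ b * (-1) ^+ k.-1.
  have [<- <-] := ends b; rewrite -nth0 -nth_last size_entries.
  by rewrite (nth_entries _ (Ordinal m0)) (nth_entries _ (Ordinal m1)).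
have neq1 : (-1) ^+ true != (-1) ^+ false :> R.
  by rewrite expr1 expr0 -subr_eq0 -opprD oppr_eq0 (_ : 1 + 1 = 2%:R) ?pnatr_eq0.
(* Some end of [y] lies outside the window, where both fillings agree: the first end if i > 0,
   otherwise the last one. *)
have [i0|i0] := posnP i; last first.
  case/eqP: neq1; have [<- _] := signE true; have [<- _] := signE false.
  by rewrite eq_out // => t; rewrite -val_eqE /=; lia.
have km : (k < m)%N.
  rewrite ltnNge; apply/negP => mk.
  have ck : (c < k)%N by apply: leq_trans mk.
  by have /negP[] := cout (Ordinal ck); rewrite -val_eqE /= i0.
case/eqP: neq1; apply: (@mulIf _ ((-1) ^+ k.-1)); first by rewrite signr_eq0.
have [_ <-] := signE true; have [_ <-] := signE false.
by rewrite eq_out // => t; rewrite -val_eqE /= i0; have := ltn_ord t; lia.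
Qed.

End Window.

(** * Passage to contiguous submatrices: (2) => (3) *)

Section TestVectors.
Variables (R : realType) (m n : nat) (A : 'M[R]_(m, n)) (eps : nat -> R).
Hypothesis vd : forall x : 'cV[R]_n, x != 0 -> (Splus (A *m x) <= Sminus x)%N.
Hypothesis ends : forall (x : 'cV[R]_n) (r : nat), A *m x != 0 ->
  Splus (A *m x) = r -> Sminus x = r -> (r <= minn m n - 1)%N ->
  end_signs_agree (eps r * eps r.+1) (A *m x) x.
Variables (k i j : nat) (hi : (i + k <= m)%N) (hj : (j + k <= n)%N).
Hypothesis k_gt0 : (0 < k)%N.
Let Ak := contig_sub hi hj A.

Lemma contig_mul (x : 'cV[R]_k) :
  Ak *m x = rowsub (window_ord hi) (A *m embed hj x).
Proof.
have AG : A *m colsub (window_ord hj) 1%:M = colsub (window_ord hj) A.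
  rewrite -[in RHS](mulmx1 A); apply/matrixP => s t; rewrite !mxE.
  by apply: eq_bigr => c _; rewrite !mxE.
rewrite /embed mulmxA AG; apply/colP => s; rewrite !mxE.
by apply: eq_bigr => t _; rewrite !mxE.
Qed.

Section Vector.
Variables (x : 'cV[R]_k) (x_neq0 : x != 0).
Let y := A *m embed hj x.

Let embed_neq0 : embed hj x != 0.
Proof.
apply: contraNneq x_neq0 => x0; rewrite -(rowsub_embed hj x) x0.
by apply/eqP/colP => s; rewrite !mxE.
Qed.

Let Sy : (Splus y <= Sminus x)%N.
Proof. by rewrite -(Sminus_embed hj) vd. Qed.

Let Sx : (Sminus x < k)%N.
Proof. by have := Sminus_leq x; lia. Qed.

Let y_neq0 : y != 0.
Proof.
apply: contraTneq Sy => y0; rewrite /Splus y0 eqxx -ltnNge.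
by apply: leq_trans Sx _; lia.
Qed.

(** Otherwise [y] vanishes on the window, and k <= S^+(y) <= S^-(x) < k. *)
Lemma contig_mul_neq0 : Ak *m x != 0.
Proof.
rewrite contig_mul; apply/eqP => /(Splus_zero_window k_gt0 y_neq0).
by rewrite leqNgt (leq_ltn_trans Sy Sx).
Qed.

Lemma contig_Splus_le : (Splus (Ak *m x) <= Splus y)%N.
Proof.
have [s <-] := Splus_attained contig_mul_neq0; rewrite contig_mul.
exact: leq_trans (fill_changes_window _ _ _ k_gt0) (fill_changes_Splus _ _).
Qed.

Lemma contig_Splus_Sminus : (Splus (Ak *m x) <= Sminus x)%N.
Proof. exact: leq_trans contig_Splus_le Sy. Qed.

(** The chain S^+(A_k x) <= S^+(y) <= S^-(x) collapses, so an optimal assignment on the window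
    extends to an optimal one for [y], with the same end signs. *)
Lemma contig_end_signs r : Splus (Ak *m x) = r -> Sminus x = r ->
  end_signs_agree (eps r * eps r.+1) (Ak *m x) x.
Proof.
move=> hS hx s; rewrite hS => sr.
have Syr : Splus y = r.
  by apply/eqP; rewrite eqn_leq -{1}hx Sy -hS contig_Splus_le.
have sy : fill_changes y (extend_fill hi s) = r.
  apply/eqP; rewrite eqn_leq -{1}Syr fill_changes_Splus //=.
  by rewrite -sr contig_mul fill_changes_window.
have rmn : (r <= minn m n - 1)%N by have := Sx; rewrite hx; lia.
have := ends y_neq0 Syr _ rmn; rewrite Sminus_embed => /(_ hx (extend_fill hi s)).
rewrite Syr nonzero_entries_embed => /(_ sy).
move: sr; rewrite contig_mul -sy => sr.
by have [-> ->] := fill_ends_window k_gt0 (esym sr).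
Qed.

End Vector.

Lemma contig_det_neq0 : \det Ak != 0.
Proof.
rewrite -det_tr; apply/det0P => -[v v0 vA].
have : Ak *m v^T != 0 by apply: contig_mul_neq0; rewrite trmx_eq0.
by rewrite -trmx_eq0 trmx_mul trmxK vA eqxx.
Qed.

Lemma test_vector_neq0 (v : 'cV[R]_k) : v != 0 -> \adj Ak *m v != 0.
Proof.
move=> v0; apply: contra_neq v0 => x0.
have : \det Ak *: v = 0 by rewrite -mul_scalar_mx -mul_mx_adj -mulmxA x0 mulmx0.
by move/eqP; rewrite scaler_eq0 (negbTE contig_det_neq0) => /eqP.
Qed.

End TestVectors.

(* alpha k i j is the vector (alpha_1, ..., alpha_k) fixed for the contiguous
   k x k submatrix with top left corner (i, j). *)
Theorem theoremB (R : realType) (m n : nat) (hm : (1 <= m)%N) (hn : (1 <= n)%N)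
    (A : 'M[R]_(m, n)) (eps : nat -> R)
    (eps0 : eps 0%N = 1)
    (epsP : forall r : nat, (1 <= r <= minn m n)%N -> eps r = 1 \/ eps r = -1)
    (alpha : forall k i j : nat, 'cV[R]_k)
    (alphaP : forall k i j : nat,
       (1 <= k)%N -> (i + k <= m)%N -> (j + k <= n)%N ->
       (forall a : 'I_k, 0 <= alpha k i j a 0) /\ alternate (alpha k i j) != 0) :
  [<-> SSR eps A
    ;  (forall x : 'cV[R]_n, x != 0 -> (Splus (A *m x) <= Sminus x)%N) /\
       (forall (x : 'cV[R]_n) (r : nat), A *m x != 0 ->
          Splus (A *m x) = r -> Sminus x = r -> (r <= minn m n - 1)%N ->
          end_signs_agree (eps r * eps r.+1) (A *m x) x)
    ;  forall (k i j : nat) (hi : (i + k <= m)%N) (hj : (j + k <= n)%N),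
         (1 <= k)%N ->
         let Ak := contig_sub hi hj A in
         let x := \adj Ak *m alternate (alpha k i j) in
         (Splus (Ak *m x) <= Sminus x)%N /\
         (forall r : nat, Splus (Ak *m x) = r -> Sminus x = r ->
            (r <= k - 1)%N ->
            end_signs_agree (eps r * eps r.+1) (Ak *m x) x)].
Proof.
have e2 r : (r <= minn m n)%N -> eps r * eps r = 1.
  case: r => [|r] rmn; first by rewrite eps0 mulr1.
  by have [->|->] := epsP r.+1 rmn; rewrite ?mulrNN mulr1.
tfae.
- move=> ssr; split=> [x x0|x r y0 Sy Sx rmn].
    (* If S^-(x) >= m, the bound is trivial, since S^+ never exceeds the dimension m. *)
    have [pm|mp] := ltnP (Sminus x) m; last exact: leq_trans (Splus_leq_size _) mp.
    by have [] := Splus_of_SSR ssr eps0 e2 x0 pm.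
  have x0 : x != 0 by apply: contraNneq y0 => ->; rewrite mulmx0.
  have pm : (Sminus x < m)%N by rewrite Sx; lia.
  by rewrite -Sx; apply: (end_signs_of_SSR ssr eps0 e2 x0 pm); rewrite Sy Sx.
- move=> [vd ends] k i j hi hj k0 Ak x.
  have x0 : x != 0.
    by apply: (test_vector_neq0 vd) => //; have [] := alphaP k i j k0 hi hj.
  split; first exact: contig_Splus_Sminus.
  by move=> r hS hx _; apply: (contig_end_signs vd ends).
- case: m n hm hn A epsP alphaP {e2} => [|m'] // [|n'] // _ _ B eP aP.
  exact: SSR_of_test_vectors.
Qed.
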